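(* Let $M$ be an $n\times n$ primitive Boolean matrix with Boolean rank $b=b(M)$ satisfying $3\leq b\leq n-1$. Then $$k(M)=\left\lceil\frac{(b-1)^2+1}{2}\right\rceil+1$$ if and only if $M$ has a Boolean rank factorization $M=AB$ (with $A$ an $n\times b$ and $B$ a $b\times n$ Boolean matrix) such that: (i) $BA=W_b$; (ii) some row of $A$ equals $e_{\lfloor b/2\rfloor}^t(b)$ and some row of $A$ equals $e_b^t(b)$; (iii) no column of $B$ equals $e_{b-1}(b)+e_{b}(b)$.
   Context: Boolean matrices are $(0,1)$-matrices with Boolean arithmetic ($1+1=1$). A square Boolean matrix $M$ is primitive if some power $M^r$ has all entries $1$. The scrambling index $k(M)$ of a primitive $M$ is the smallest positive integer $k$ such that any two rows of $M^k$ have a $1$ in a common position (equivalently $M^k(M^t)^k=J$, the all-ones matrix). The Boolean rank $b(M)$ is the smallest $b$ such that $M=AB$ with $A$ of size $n\times b$ and $B$ of size $b\times n$ Boolean; such a factorization is a Boolean rank factorization. $e_i(b)$ is the $i$th column of the $b\times b$ identity matrix. For $b\geq 3$, $W_b$ is the $b\times b$ $(0,1)$-matrix whose $1$ entries are exactly in positions $(i,i+1)$ for $1\leq i\leq b-1$, together with positions $(b-1,1)$ and $(b,1)$. *)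

(* Defs.v *)
From mathcomp Require Import all_boot all_order all_algebra.
Set Implicit Arguments. Unset Strict Implicit. Unset Printing Implicit Defensive.

Definition bmul (m p n : nat) (A : 'M[bool]_(m, p)) (B : 'M[bool]_(p, n))
  : 'M[bool]_(m, n) :=
  \matrix_(i < m, j < n) [exists k : 'I_p, A i k && B k j].

Definition bid (n : nat) : 'M[bool]_n := \matrix_(i < n, j < n) (i == j).
Definition bJ (m n : nat) : 'M[bool]_(m, n) := const_mx true.

Fixpoint bpow (n : nat) (M : 'M[bool]_n) (k : nat) : 'M[bool]_n :=
  match k with
  | 0 => bid n
  | k'.+1 => bmul M (bpow M k')
  end.

Definition primitive (n : nat) (M : 'M[bool]_n) : Prop :=
  exists r, 0 < r /\ bpow M r = bJ n n.

Definition scrambles (n : nat) (M : 'M[bool]_n) (k : nat) : Prop :=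
  bmul (bpow M k) (bpow M^T k) = bJ n n.

Definition is_scrambling_index (n : nat) (M : 'M[bool]_n) (k : nat) : Prop :=
  0 < k /\ scrambles M k /\ (forall k', 0 < k' -> k' < k -> ~ scrambles M k').

Definition has_bfactorization (n : nat) (M : 'M[bool]_n) (b : nat) : Prop :=
  exists (A : 'M[bool]_(n, b)) (B : 'M[bool]_(b, n)), M = bmul A B.

Definition boolean_rank (n : nat) (M : 'M[bool]_n) (b : nat) : Prop :=
  has_bfactorization M b /\ (forall b', b' < b -> ~ has_bfactorization M b').

(* W_b (1-based positions (i,i+1), i <= b-1, and (b-1,1), (b,1));
   0-based: (i, i+1) for i <= b-2, and (b-2, 0), (b-1, 0). *)
Definition W (b : nat) : 'M[bool]_b :=
  \matrix_(i < b, j < b) ((nat_of_ord j == (nat_of_ord i).+1)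
                          || ((nat_of_ord j == 0) && (b - 2 <= nat_of_ord i))).

(* row r of A equals e_p^t(b) (1-based index p). *)
Definition row_is_unit (n b : nat) (A : 'M[bool]_(n, b)) (r : 'I_n) (p : nat) : Prop :=
  forall j : 'I_b, A r j = (nat_of_ord j == p.-1).

(* Main.v *)
Require Import Defs.
From mathcomp Require Import all_boot all_order all_algebra.
From mathcomp Require Import zify.
Set Implicit Arguments. Unset Strict Implicit. Unset Printing Implicit Defensive.

(** Write [L] for the integer part of [(b - 1)^2 / 2]. If [M = A B] and
    [N = B A], then [M^(t+1) = A N^t B], so [M] is scrambling one step after
    [N]. In [W_b], whose only cycles have lengths [b - 1] and [b], two walkers
    meet by letting one make short laps and the other long laps; every pair of
    vertices meets after [L] steps except the pair (floor(b/2), b), which meets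
    only at step [L + 1], through the two vertices [b - 1] and [b] that have a
    common successor. Hence it suffices to show that a primitive [N] with a
    pair not meeting after [L] steps is a relabelled [W_b].

    Let [s] be the girth of [N]. The set of vertices reachable in [j s] steps
    from a vertex of a shortest cycle has at least [j + 1] elements, so two such
    sets intersect once [j] reaches the integer part of [b / 2]; this settles
    [s <= b - 2], except for [b] even and [s = b - 2], where a cycle of odd length
    [b - 1] allows the two vertices outside the shortest cycle to catch up. For
    [s = b - 1] there are a Hamiltonian cycle and a chord, that is, a copy of [W_b],
    and any further arc yields a second copy with a different critical pair. *)

(** * Boolean powers and walks *)

Lemma bmulP m p n (A : 'M[bool]_(m, p)) (B : 'M[bool]_(p, n)) i j :
  reflect (exists2 k, A i k & B k j) (bmul A B i j).
Proof. by rewrite mxE; apply: (iffP exists_inP). Qed.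

Lemma bmulA m p q n (A : 'M[bool]_(m, p)) (B : 'M[bool]_(p, q))
    (C : 'M[bool]_(q, n)) : bmul A (bmul B C) = bmul (bmul A B) C.
Proof.
apply/matrixP => i j; apply/bmulP/bmulP.
  by move=> [k Aik /bmulP[l Bkl Clj]]; exists l => //; apply/bmulP; exists k.
by move=> [l /bmulP[k Aik Bkl] Clj]; exists k => //; apply/bmulP; exists l.
Qed.

Lemma bmul1m m n (A : 'M[bool]_(m, n)) : bmul (bid m) A = A.
Proof.
apply/matrixP => i j; apply/bmulP/idP => [[k]|Aij].
  by rewrite mxE => /eqP->.
by exists i => //; rewrite mxE.
Qed.

Lemma bmulm1 m n (A : 'M[bool]_(m, n)) : bmul A (bid n) = A.
Proof.
apply/matrixP => i j; apply/bmulP/idP => [[k ?]|Aij].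
  by rewrite mxE => /eqP<-.
by exists j => //; rewrite mxE.
Qed.

Lemma bpowD n (M : 'M[bool]_n) s t :
  bpow M (s + t) = bmul (bpow M s) (bpow M t).
Proof. by elim: s => [|s IHs]; rewrite ?bmul1m //= IHs bmulA. Qed.

Lemma bpow1 n (M : 'M[bool]_n) : bpow M 1 = M.
Proof. exact: bmulm1. Qed.

Lemma bpow_cat n (M : 'M[bool]_n) s t i j k :
  bpow M s i j -> bpow M t j k -> bpow M (s + t) i k.
Proof. by move=> ij jk; rewrite bpowD; apply/bmulP; exists j. Qed.

Lemma bpow_tr n (M : 'M[bool]_n) t : bpow M^T t = (bpow M t)^T%R.
Proof.
elim: t => [|t IHt]; first by apply/matrixP => i j; rewrite !mxE eq_sym.
rewrite -[in RHS]addn1 bpowD bpow1 /= IHt; apply/matrixP => i j.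
rewrite [RHS]mxE.
by apply/bmulP/bmulP => -[k]; rewrite ?mxE => *; exists k; rewrite ?mxE.
Qed.

Lemma bpow_swap n b (A : 'M[bool]_(n, b)) (B : 'M[bool]_(b, n)) t :
  bpow (bmul A B) t.+1 = bmul A (bmul (bpow (bmul B A) t) B).
Proof.
elim: t => [|t IHt]; first by rewrite bpow1 bmul1m.
by rewrite -add1n bpowD IHt bpow1 /= !bmulA.
Qed.

Definition meet n (M : 'M[bool]_n) (t : nat) (i j : 'I_n) : Prop :=
  exists2 w, bpow M t i w & bpow M t j w.

Lemma scramblesP n (M : 'M[bool]_n) t :
  scrambles M t <-> forall i j, meet M t i j.
Proof.
rewrite /scrambles bpow_tr; split=> [/matrixP scr i j|scr].
  have : bmul (bpow M t) (bpow M t)^T%R i j by rewrite scr mxE.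
  by case/bmulP => w iw; rewrite mxE; exists w.
apply/matrixP => i j; rewrite [RHS]mxE; apply/bmulP.
by have [w iw jw] := scr i j; exists w; rewrite ?mxE.
Qed.

Lemma meetC n (M : 'M[bool]_n) t i j : meet M t i j -> meet M t j i.
Proof. by case=> w; exists w. Qed.

Lemma meet_cat n (M : 'M[bool]_n) s t i j i' j' :
  bpow M s i i' -> bpow M s j j' -> meet M t i' j' -> meet M (s + t) i j.
Proof. by move=> ii' jj' [w i'w j'w]; exists w; apply: bpow_cat; eassumption. Qed.

Definition serial n (M : 'M[bool]_n) : Prop := forall i, exists j, M i j.

(** After meeting, both walkers follow one common walk, which never gets stuck because every vertex
    has a successor. *)
Lemma meet_leq n (M : 'M[bool]_n) s t i j :
  serial M -> s <= t -> meet M s i j -> meet M t i j.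
Proof.
move=> serM /subnK<-; elim: (t - s) => [//|d IHd] /IHd[w iw jw].
have [x wx] := serM w; rewrite addSnnS addnS -addn1.
by exists x; apply: (@bpow_cat _ _ _ 1 _ w); rewrite ?bpow1 // addnC.
Qed.

Lemma primitive_serial n (M : 'M[bool]_n) : primitive M -> serial M.
Proof.
case=> -[[]//|r] [_ /matrixP MJ] i.
have /bmulP[k Mik _] : bpow M r.+1 i i by rewrite MJ mxE.
by exists k.
Qed.

Lemma primitive_eventually n (M : 'M[bool]_n) :
  primitive M -> exists r, forall t, r <= t -> forall i j, bpow M t i j.
Proof.
move=> primM; have serM := primitive_serial primM.
case: primM => r [_ /matrixP MJ]; exists r => t /subnK<-.
elim: (t - r) => [|d IHd] i j; first by rewrite MJ mxE.
by have [k Mik] := serM i; apply/bmulP; exists k.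
Qed.

Lemma bpow_path n (M : 'M[bool]_n) t u v : bpow M t u v ->
  exists f : nat -> 'I_n,
    [/\ f 0 = u, f t = v & forall i, i < t -> M (f i) (f i.+1)].
Proof.
elim: t u => [|t IHt] u /=.
  by rewrite mxE => /eqP->; exists (fun=> v).
case/bmulP=> w Muw /IHt[f [f0 ft fM]].
exists (fun i => if i is i'.+1 then f i' else u); split=> // -[_|i /fM//].
by rewrite f0.
Qed.

Lemma path_bpow n (M : 'M[bool]_n) (f : nat -> 'I_n) i k :
  (forall x, i <= x < i + k -> M (f x) (f x.+1)) -> bpow M k (f i) (f (i + k)).
Proof.
elim: k i => [|k IHk] i fM; first by rewrite addn0 mxE.
apply/bmulP; exists (f i.+1); first by apply: fM; lia.
by rewrite addnS -addSn; apply: IHk => x xP; apply: fM; lia.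
Qed.

Definition is_cycle n (M : 'M[bool]_n) (c : nat -> 'I_n) (s : nat) : Prop :=
  [/\ 0 < s, forall i, M (c i) (c i.+1), forall i, c (i + s) = c i
    & forall i j, i < s -> j < s -> c i = c j -> i = j].

(* A shortest closed walk among those whose length is not divisible by [m] has
   no repeated vertex: a repetition would split it in two closed walks, one of
   which would again have length not divisible by [m]. *)
Lemma minimal_cycle n (M : 'M[bool]_n) m :
  0 < n -> primitive M -> m != 1 ->
  exists s c, [/\ is_cycle M c s, ~~ (m %| s)
    & forall t u, bpow M t u u -> ~~ (m %| t) -> s <= t].
Proof.
move=> n_gt0 /primitive_eventually[r Mr] m_neq1.
pose P t := ~~ (m %| t) && [exists u, bpow M t u u].
have exP : exists t, P t.
  have exu t : r <= t -> [exists u, bpow M t u u].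
    by move=> ?; apply/existsP; exists (Ordinal n_gt0); apply: Mr.
  (* Every length from [r] on carries a closed walk, and [m] cannot divide both [r] and [r + 1]. *)
  have [mr|mr] := boolP (m %| r); last by exists r; rewrite /P mr exu.
  exists r.+1; rewrite /P exu // andbT -addn1 dvdn_addr // dvdn1.
  exact: m_neq1.
case: (ex_minnP exP) => s /andP[ms /existsP[u Mu]] smin.
have sminP t v : bpow M t v v -> ~~ (m %| t) -> s <= t.
  by move=> Mv mt; apply: smin; rewrite /P mt; apply/existsP; exists v.
have s_gt0 : 0 < s by case: (s) ms => //; rewrite dvdn0.
have [f [f0 fs fM]] := bpow_path Mu.
have walk i j : i <= j -> j <= s -> bpow M (j - i) (f i) (f j).
  move=> ij js; rewrite -{2}(subnKC ij); apply: path_bpow => x xP.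
  by apply: fM; lia.
have finj i j : i < j -> j < s -> f i <> f j.
  move=> ij js fij; have := @sminP (j - i) (f i).
  have := @sminP (s - j + (i - 0)) (f j).
  rewrite {2}fij walk ?(ltnW ij) ?(ltnW js) // -{2}fij.
  rewrite (@bpow_cat _ _ _ _ _ u) ?walk //; first last.
  - by rewrite -f0 walk //; lia.
  - by rewrite -fs walk //; lia.
  have [mij|mij] := boolP (m %| j - i); last by move=> _ /(_ isT isT); lia.
  have -> : m %| s - j + (i - 0) = false.
    apply: contraNF ms => mji; have -> : s = (s - j + (i - 0)) + (j - i) by lia.
    exact: dvdn_add.
  by move=> /(_ isT isT); lia.
exists s, (fun i => f (i %% s)); split=> //; split=> //.
- move=> i; have := fM (i %% s) (ltn_pmod i s_gt0); rewrite modnS.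
  case: ifP => // si; have -> // : (i %% s).+1 = s.
    have := ltn_pmod i s_gt0; rewrite leq_eqVlt => /predU1P[//|].
    by move: si; rewrite /dvdn -addn1 -modnDml => /eqP + ?; rewrite modn_small; lia.
  by rewrite fs f0.
- by move=> i; rewrite modnDr.
move=> i j si sj; rewrite !modn_small // => fij.
by have [/finj/(_ sj)|/finj/(_ si)/nesym|] := ltngtP i j.
Qed.

(** * Walks in W_b *)

Lemma bpow_laps n (M : 'M[bool]_n) s u k : bpow M s u u -> bpow M (k * s) u u.
Proof.
move=> Mu; elim: k => [|k IHk]; first by rewrite mul0n mxE.
by rewrite mulSn; apply: bpow_cat IHk.
Qed.

(* [crit b + 2] is the value of the scrambling index in the theorem. *)
Definition crit (b : nat) : nat := (b - 1) ^ 2 %/ 2.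

(** Splitting on the parity of [b] removes the division from [crit] and turns the bounds below into
    polynomial inequalities in [h]. *)
Lemma crit_cases b : 3 <= b ->
  exists h, 0 < h /\ (b = 2 * h + 1 /\ crit b = 2 * (h * h)
                  \/ [/\ b = 2 * h, 2 <= h & crit b = 2 * (h * (h - 1))]).
Proof.
move=> b3; exists (b %/ 2); split; first lia.
have bE := divn_eq b 2; have : b %% 2 < 2 by rewrite ltn_mod.
rewrite /crit; move: (b %/ 2) bE b3 => h.
case: (b %% 2) => [|[|//]] {b}-> b3 _.
  right; split; [lia|lia|].
  have -> : (h * 2 + 0 - 1) ^ 2 = (h * (h - 1)) * 4 + 1.
    by case: h b3 => [//|h] _; rewrite !expnS expn0 subn1 /=; nia.
  by lia.
left; split; first lia.
have -> : (h * 2 + 1 - 1) ^ 2 = (h * h) * 4 by rewrite !expnS expn0; nia.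
by lia.
Qed.

(** For two walkers at distance [d], this bounds the cost of [d] short laps, and [crit_long] that of
    the alternative, [b - 1 - d] long laps; one of the two is always in time. *)
Lemma crit_short b d : 3 <= b -> d <= (b - 1) %/ 2 -> d * (b - 1) <= crit b.
Proof.
move=> b3 dh; have [h [h0 [[bE ->]|[bE h2 ->]]]] := crit_cases b3; subst b.
  have dh' : d <= h by lia.
  by have := leq_mul2r h d h; nia.
have dh' : d <= h - 1 by lia.
by have := leq_mul dh' (leqnn (2 * h - 1)); nia.
Qed.

Lemma crit_long b d : 3 <= b -> (b - 1) %/ 2 < d -> (b - 1 - d) * b <= crit b.
Proof.
move=> b3 dh; have [h [h0 [[bE ->]|[bE h2 ->]]]] := crit_cases b3; subst b.
  have dh' : 2 * h + 1 - 1 - d <= h - 1 by lia.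
  by have := leq_mul dh' (leqnn (2 * h + 1)); nia.
have dh' : 2 * h - 1 - d <= h - 1 by lia.
by have := leq_mul dh' (leqnn (2 * h)); nia.
Qed.

(** The strict versions leave room for one extra step. Both fail exactly at [d = b %/ 2], which is
    the origin of the critical pair. *)
Lemma crit_short_lt b d : 3 <= b -> d < b %/ 2 -> d * (b - 1) < crit b.
Proof.
move=> b3 dh; have [h [h0 [[bE ->]|[bE h2 ->]]]] := crit_cases b3; subst b.
  have dh' : d <= h - 1 by lia.
  by have := leq_mul dh' (leqnn (2 * h)); nia.
have dh' : d <= h - 1 by lia.
by have := leq_mul dh' (leqnn (2 * h - 1)); nia.
Qed.

Lemma crit_long_lt b d : 3 <= b -> b %/ 2 < d -> (b - 1 - d) * b < crit b.
Proof.
move=> b3 dh; have [h [h0 [[bE ->]|[bE h2 ->]]]] := crit_cases b3; subst b.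
  have dh' : 2 * h + 1 - 1 - d <= h - 1 by lia.
  by have := leq_mul dh' (leqnn (2 * h + 1)); nia.
have dh' : 2 * h - 1 - d <= h - 2 by lia.
by have := leq_mul dh' (leqnn (2 * h)); nia.
Qed.

(** The equations describe walks to [w]: one of length [c + 1] from vertex [b %/ 2 - 1], and one of
    length [c] from vertex 0. The numbers [q], [q'] count laps, [m], [m'] the long ones among them.
    Comparing the two forces [q = q'] or [q = q' + 1], and then [m] or [m'] exceeds its number of
    laps. *)
Lemma crit_no_common_length b c w q m q' m' : 3 <= b -> crit b = c.+1 ->
  m <= q -> m' <= q' -> b %/ 2 + c = w + q * (b - 1) + m ->
  c = w + q' * (b - 1) + m' -> False.
Proof.
move=> b3 cE mq mq' E E'.
have [h [h0 hb]] := crit_cases b3.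
have bh : b %/ 2 = h by case: hb => [[->]|[->]]; lia.
rewrite bh cE in E hb; have [g gE] : exists g, b = g.+1 by exists b.-1; lia.
have Eq : q * g <= h + c by move: E; rewrite gE subn1 /=; lia.
have {}E : h + q' * g + m' = q * g + m by move: E E'; rewrite gE subn1 /=; lia.
have {}E' : q' * g <= c by move: E'; rewrite gE subn1 /=; lia.
have hg : h <= g by lia.
have q'h : q' < h.
  rewrite ltnNge; apply/negP => /leq_mul/(_ (leqnn g)).
  by case: hb => [[bE hE]|[bE h2 hE]]; nia.
have [qq|qq] := ltnP q q'.
  by have := leq_mul qq (leqnn g); lia.
have [qq'|qq'] := ltnP q'.+1 q.
  by have := leq_mul qq' (leqnn g); lia.
have [qE|qE] : q = q' \/ q = q'.+1 by lia.
  by subst q; lia.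
subst q; case: hb => [[bE hE]|[bE h2 hE]]; first by nia.
have q'h1 : q'.+1 < h.
  by rewrite ltnNge; apply/negP => /leq_mul/(_ (leqnn g)); nia.
by lia.
Qed.

Lemma WE b (i j : 'I_b) :
  W b i j = (j == i.+1 :> nat) || ((j == 0 :> nat) && (b - 2 <= i)).
Proof. by rewrite mxE. Qed.

Lemma W_serial b : 3 <= b -> serial (W b).
Proof.
move=> b3 i; have [ib|ib] := ltnP i.+1 b.
  by exists (Ordinal ib); rewrite WE /= eqxx.
have b0 : 0 < b by lia.
by exists (Ordinal b0); rewrite WE /=; lia.
Qed.

Lemma W_forward b k (i j : 'I_b) : j = i + k :> nat -> bpow (W b) k i j.
Proof.
elim: k i => [|k IHk] i jE; first by rewrite mxE -val_eqE /= jE addn0.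
have ib : i.+1 < b by have := ltn_ord j; lia.
apply/bmulP; exists (Ordinal ib); first by rewrite WE /= eqxx.
by apply: IHk => /=; lia.
Qed.

(** A walker at [i] is already [i] steps into its first lap; this accounts for the subtraction, here
    and in [W_short]. *)
Lemma W_long b (i z : 'I_b) q :
  3 <= b -> z = 0 :> nat -> bpow (W b) (q.+1 * b - i) i z.
Proof.
move=> b3 z0; have lb : b.-1 < b by lia.
have to0 (x : 'I_b) : bpow (W b) (b - x) x z.
  have -> : b - x = (b - x).-1 + 1 by have := ltn_ord x; lia.
  apply: (@bpow_cat _ _ _ _ _ (Ordinal lb)).
    by apply: W_forward => /=; have := ltn_ord x; lia.
  by rewrite bpow1 WE /=; lia.
have -> : q.+1 * b - i = (b - i) + q * (b - z) by have := ltn_ord i; nia.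
by apply: bpow_cat (to0 i) _; apply: bpow_laps.
Qed.

Lemma W_short b (i z : 'I_b) q : 3 <= b -> z = 0 :> nat -> i <= b - 2 ->
  bpow (W b) (q.+1 * (b - 1) - i) i z.
Proof.
move=> b3 z0 ib; have lb : b - 2 < b by lia.
have to0 (x : 'I_b) : x <= b - 2 -> bpow (W b) (b - 1 - x) x z.
  move=> xb; have -> : b - 1 - x = (b - 2 - x) + 1 by lia.
  apply: (@bpow_cat _ _ _ _ _ (Ordinal lb)).
    by apply: W_forward => /=; lia.
  by rewrite bpow1 WE /=; lia.
have -> : q.+1 * (b - 1) - i = (b - 1 - i) + q * (b - 1 - z) by nia.
by apply: bpow_cat (to0 i ib) _; apply: bpow_laps; apply: to0; lia.
Qed.

(* With [d = j - i], either [j] makes [d] long laps while [i] makes [d] short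
   ones, or [i] makes [b - 1 - d] long laps while [j] makes [b - d] short ones. *)
Lemma W_meet_low b (i j : 'I_b) : 3 <= b -> i < j -> j <= b - 2 ->
  meet (W b) ((j - i) * (b - 1) - i) i j /\
  meet (W b) ((b - 1 - (j - i)) * b - i) i j.
Proof.
move=> b3 ij jb; have b0 : 0 < b by lia.
have z0 : Ordinal b0 = 0 :> nat by [].
split; exists (Ordinal b0).
- have -> : j - i = (j - i).-1.+1 by lia.
  by apply: W_short => //; lia.
- have -> : (j - i) * (b - 1) - i = (j - i).-1.+1 * b - j by nia.
  exact: W_long.
- have -> : b - 1 - (j - i) = (b - 2 - (j - i)).+1 by lia.
  exact: W_long.
have -> : (b - 1 - (j - i)) * b - i = (b - 1 - (j - i)).+1 * (b - 1) - j by nia.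
exact: W_short.
Qed.

(** The last vertex moves to 0 in one step and then makes laps of one kind, while [i] makes laps of
    the other kind; [i + 1] plays the role of the distance. *)
Lemma W_meet_top b (i l : 'I_b) : 3 <= b -> i <= b - 2 -> l = b.-1 :> nat ->
  meet (W b) (i.+1 * (b - 1) + 1) i l /\ meet (W b) ((b - 2 - i) * b + 1) i l.
Proof.
move=> b3 ib lb; have b0 : 0 < b by lia.
have z0 : Ordinal b0 = 0 :> nat by [].
have lz : bpow (W b) 1 l (Ordinal b0) by rewrite bpow1 WE /=; lia.
split; exists (Ordinal b0).
- have -> : i.+1 * (b - 1) + 1 = i.+1 * b - i by nia.
  exact: W_long.
- rewrite addnC; apply: bpow_cat lz _; apply: bpow_laps.
  by have := @W_short b (Ordinal b0) (Ordinal b0) 0 b3 z0; rewrite mul1n subn0; apply.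
- have -> : (b - 2 - i) * b + 1 = (b - 2 - i).+1 * (b - 1) - i by nia.
  exact: W_short.
rewrite addnC; apply: bpow_cat lz _; apply: bpow_laps.
by have := @W_long b (Ordinal b0) (Ordinal b0) 0 b3 z0; rewrite mul1n subn0; apply.
Qed.

(* The vertices floor(b/2) and b of the paper, in 0-based numbering. *)
Definition critical_pair (b : nat) (i j : 'I_b) : bool :=
  (i == (b %/ 2).-1 :> nat) && (j == b.-1 :> nat).

Lemma W_meet_crit b (i j : 'I_b) : 3 <= b ->
  ~~ critical_pair i j -> ~~ critical_pair j i -> meet (W b) (crit b) i j.
Proof.
move=> b3; have serW := W_serial b3.
wlog ij : i j / i < j => [hwlog|].
  have [/hwlog//|ji ? ?|/val_inj-> _ _] := ltngtP i j.
    by apply: meetC; apply: hwlog.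
  have b0 : 0 < b by lia.
  apply: (@meet_leq _ _ 0) => //; exists j; rewrite mxE; exact: eqxx.
move=> nij _; have := ltn_ord j => jlt.
have [jb|jb] := leqP j (b - 2).
  have [mA mB] := W_meet_low b3 ij jb.
  have [dh|dh] := leqP (j - i) ((b - 1) %/ 2).
    by apply: meet_leq mA => //; apply: leq_trans (crit_short b3 dh); apply: leq_subr.
  by apply: meet_leq mB => //; apply: leq_trans (crit_long b3 dh); apply: leq_subr.
have jE : j = b.-1 :> nat by lia.
have ib : i <= b - 2 by lia.
have [mA mB] := W_meet_top b3 ib jE.
(* The initial step to 0 requires the strict bounds, whose gap [i + 1 = b %/ 2] is excluded by
   [ih]. *)
move: nij; rewrite /critical_pair jE eqxx andbT => ih.
have [dh|dh] := ltnP i.+1 (b %/ 2).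
  by apply: meet_leq mA => //; rewrite addn1; apply: crit_short_lt.
apply: meet_leq mB => //; rewrite addn1.
have -> : b - 2 - i = b - 1 - i.+1 by lia.
by apply: crit_long_lt => //; lia.
Qed.

Lemma W_scrambles b (i j : 'I_b) : 3 <= b -> meet (W b) (crit b).+1 i j.
Proof.
move=> b3; have serW := W_serial b3.
(* With one more step available, the non-strict bounds suffice, and they leave no gap. *)
have top (x y : 'I_b) : critical_pair x y -> meet (W b) (crit b).+1 x y.
  case/andP=> /eqP xE /eqP yE; have xb : x <= b - 2 by lia.
  have [mA mB] := W_meet_top b3 xb yE.
  have [dh|dh] := leqP x.+1 ((b - 1) %/ 2).
    by apply: meet_leq mA => //; rewrite addn1 ltnS; apply: crit_short.
  apply: meet_leq mB => //; rewrite addn1 ltnS.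
  have -> : b - 2 - x = b - 1 - x.+1 by lia.
  exact: crit_long.
have [/top//|nij] := boolP (critical_pair i j).
have [/top/meetC//|nji] := boolP (critical_pair j i).
by apply: (@meet_leq _ _ (crit b)) => //; apply: W_meet_crit.
Qed.

(** Here [q] counts the returns to vertex 0 and [m] those made from the last vertex, each of which
    costs one step more. *)
Lemma W_walk_length b t (i w : 'I_b) : 3 <= b -> i <= b - 2 -> bpow (W b) t i w ->
  exists q m, m <= q /\ i + t = w + q * (b - 1) + m.
Proof.
move=> b3 ib; elim: t w => [|t IHt] w.
  by rewrite mxE => /eqP->; exists 0, 0; lia.
rewrite -addn1 bpowD bpow1 => /bmulP[x /IHt[q [m [mq E]]]]; rewrite WE.
have := ltn_ord x => xb /orP[/eqP wE|/andP[/eqP wE xE]].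
  by exists q, m; lia.
have [xE'|xE'] := eqVneq (x : nat) (b - 2); first by exists q.+1, m; nia.
by exists q.+1, m.+1; nia.
Qed.

Lemma W_not_meet_crit b (i j : 'I_b) : 3 <= b ->
  critical_pair i j -> ~ meet (W b) (crit b) i j.
Proof.
move=> b3 /andP[/eqP iE /eqP jE] [w].
have [h [h0 hb]] := crit_cases b3.
have ib : i <= b - 2 by lia.
case/(W_walk_length b3 ib) => q [m [mq E]].
(* As [crit b] is positive, the forced first step from [j] to 0 can be split off, and
   [W_walk_length] then applies from 0. *)
have [c cE] : exists c, crit b = c.+1.
  by exists (crit b).-1; case: hb => [[_ ->]|[_ h2 ->]]; nia.
rewrite cE /= => /bmulP[x jx].
have x0 : x = 0 :> nat by move: jx (ltn_ord x); rewrite WE jE; lia.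
have xb : x <= b - 2 by lia.
case/(W_walk_length b3 xb) => q' [m' [mq' E']].
apply: (@crit_no_common_length b c w q m q' m') => //; lia.
Qed.

(** * Cycles and reachable sets *)

Lemma cycleD n (M : 'M[bool]_n) c s : is_cycle M c s ->
  forall i k, c (i + k * s) = c i.
Proof.
case=> _ _ cs _ i; elim=> [|k IHk]; first by rewrite mul0n addn0.
by rewrite mulSn addnCA addnC cs IHk.
Qed.

Lemma cycle_mod n (M : 'M[bool]_n) c s : is_cycle M c s ->
  forall i, c (i %% s) = c i.
Proof. by move=> cyc i; rewrite {2}(divn_eq i s) addnC (cycleD cyc). Qed.

Lemma cycle_inj n (M : 'M[bool]_n) c s : is_cycle M c s ->
  forall i j, c i = c j -> i = j %[mod s].
Proof.
move=> cyc i j; rewrite -(cycle_mod cyc i) -(cycle_mod cyc j).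
by case: cyc => s0 _ _ cinj; apply: cinj; rewrite ltn_mod.
Qed.

(** The congruence modulo [s] is unfolded into linear equations, which [lia] can use in the index
    computations below. *)
Lemma cycle_inj_near n (M : 'M[bool]_n) c s i j : is_cycle M c s ->
  c i = c j -> i < j + 3 * s -> j < i + 3 * s ->
  i = j \/ i = j + s \/ j = i + s \/ i = j + 2 * s \/ j = i + 2 * s.
Proof.
move=> cyc /(cycle_inj cyc); wlog ij : i j / i <= j => [hwlog|].
  have [le_ij|/ltnW le_ji] := leqP i j; first exact: hwlog.
  move=> /esym ji ij_lt ji_lt; have := hwlog _ _ le_ji ji ji_lt ij_lt.
  lia.
move/esym/eqP; rewrite eqn_mod_dvd // => /dvdnP[k kE] _ jlt.
have jE : j = i + k * s by rewrite -kE subnKC.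
have s0 : 0 < s by case: cyc.
have : k < 3 by rewrite -(ltn_pmul2r s0); lia.
by case: k {kE} jE => [|[|[|//]]]; lia.
Qed.

Lemma cycle_walk n (M : 'M[bool]_n) c s : is_cycle M c s ->
  forall i k, bpow M k (c i) (c (i + k)).
Proof. by case=> _ cM _ _ i k; apply: path_bpow. Qed.

Lemma cycle_closed n (M : 'M[bool]_n) c s : is_cycle M c s ->
  forall i, bpow M s (c i) (c i).
Proof.
by move=> cyc i; have := cycle_walk cyc i s; case: cyc => _ _ -> _.
Qed.

Definition cycle_set n (c : nat -> 'I_n) (s : nat) : {set 'I_n} :=
  [set c i | i : 'I_s].

Lemma card_cycle_set n (M : 'M[bool]_n) c s : is_cycle M c s ->
  #|cycle_set c s| = s.
Proof.
case=> _ _ _ cinj; rewrite card_imset ?card_ord // => i j /cinj.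
by move=> /(_ (ltn_ord i) (ltn_ord j))/val_inj.
Qed.

Lemma cycle_setP n (M : 'M[bool]_n) c s v : is_cycle M c s ->
  reflect (exists i, v = c i) (v \in cycle_set c s).
Proof.
move=> cyc; apply: (iffP imsetP) => [[i _ ->]|[i ->]]; first by exists i.
have s0 : 0 < s by case: cyc.
by exists (Ordinal (ltn_pmod i s0)); rewrite //= (cycle_mod cyc).
Qed.

Lemma cycle_leq n (M : 'M[bool]_n) c s : is_cycle M c s -> s <= n.
Proof.
by move=> /card_cycle_set <-; rewrite -[leqRHS]card_ord max_card.
Qed.

Lemma cycle_surj n (N : 'M[bool]_n) h : is_cycle N h n ->
  forall x, exists j, x = h j.
Proof.
move=> cyc x; apply/(cycle_setP _ cyc).
have -> : cycle_set h n = setT; last by rewrite inE.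
by apply/eqP; rewrite eqEcard subsetT cardsT card_ord (card_cycle_set cyc) leqnn.
Qed.

(** Each set determines the next, so a chain that stalls once is constant from there on; it
    therefore gains an element at every step until it is full. *)
Lemma chain_card (T : finType) (F : nat -> {set T}) (G : {set T} -> {set T}) :
  (forall j, F j.+1 = G (F j)) -> (forall j, F j \subset F j.+1) ->
  (exists r, F r = setT) -> forall j, minn #|T| (#|F 0| + j) <= #|F j|.
Proof.
move=> FG Fsub [r Fr]; elim=> [|j IHj]; first by rewrite addn0 geq_minr.
have [Fj|Fj] := eqVneq (F j.+1) (F j); last first.
  have : F j \proper F j.+1 by rewrite properEneq eq_sym Fj Fsub.
  by move/proper_card; lia.
have Fconst k : F (k + j) = F j by elim: k => // k IHk; rewrite addSn FG IHk -FG.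
have Fle k : F r \subset F (k + r).
  by elim: k => // k IHk; apply: subset_trans IHk (Fsub _).
have : F r \subset F j by rewrite -(Fconst r) addnC Fle.
rewrite Fr => /subset_leq_card; rewrite cardsT; have := subset_leq_card (Fsub j).
lia.
Qed.

(** The sets reached after successive laps increase, since the closed walk at [u] can be prefixed;
    [chain_card] applies. *)
Lemma reach_card n (M : 'M[bool]_n) s u j : primitive M -> 0 < s ->
  bpow M s u u -> minn n j.+1 <= #|[set w | bpow M (j * s) u w]|.
Proof.
move=> /primitive_eventually[r Mr] s0 Mu.
pose F k := [set w | bpow M (k * s) u w].
have := @chain_card _ F (fun X => [set w | [exists x in X, bpow M s x w]]).
rewrite card_ord => /(_ _ _ _ j); rewrite -[F j]/[set _ | _].
have -> : #|F 0| = 1.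
  rewrite -(cards1 u); apply: eq_card => w; rewrite !inE mul0n mxE; exact: eq_sym.
rewrite add1n; apply.
- move=> k; apply/setP => w; rewrite !inE mulSn addnC bpowD.
  by apply/bmulP/exists_inP => -[x]; rewrite ?inE => ? ?; exists x; rewrite ?inE.
- move=> k; apply/subsetP => w; rewrite !inE mulSn; exact: bpow_cat.
by exists r; apply/setP => w; rewrite !inE Mr // leq_pmulr.
Qed.

(** The vertices that can be on the cycle after [k] steps increase with [k], as a walk may go on
    along the cycle, and there are [s] of them at the start. *)
Lemma cycle_reach n (M : 'M[bool]_n) c s t u : primitive M -> is_cycle M c s ->
  n - s <= t -> exists i, bpow M t u (c i).
Proof.
move=> /primitive_eventually[r Mr] cyc nst.
pose F k := [set v | [exists x in cycle_set c s, bpow M k v x]].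
have := @chain_card _ F (fun X => [set v | [exists x in X, M v x]]).
rewrite card_ord => /(_ _ _ _ t).
have -> : F 0 = cycle_set c s.
  apply/setP => v; rewrite inE; apply/exists_inP/idP => [[x xC]|vC].
    by rewrite mxE => /eqP->.
  by exists v; rewrite // mxE eqxx.
have -> : minn n (#|cycle_set c s| + t) = n by rewrite (card_cycle_set cyc); lia.
have FP k v : reflect (exists i, bpow M k v (c i)) (v \in F k).
  rewrite inE; apply: (iffP exists_inP) => [[x /(cycle_setP _ cyc)[i ->]]|[i vi]].
    by exists i.
  by exists (c i) => //; apply/(cycle_setP _ cyc); exists i.
move=> nF; apply/FP; have -> : F t = setT; last by rewrite inE.
apply/eqP; rewrite eqEcard subsetT cardsT card_ord; apply: nF.
- move=> k; apply/setP => v; rewrite [in RHS]inE.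
  apply/FP/exists_inP => [[i /bmulP[x vx xi]]|[x /FP[i xi] vx]].
    by exists x => //; apply/FP; exists i.
  by exists i; apply/bmulP; exists x.
- move=> k; apply/subsetP => v /FP[i vi]; apply/FP; exists i.+1.
  by rewrite -addn1; apply: bpow_cat vi _; rewrite bpow1; case: cyc.
exists r; apply/setP => v; rewrite [RHS]inE; apply/FP; exists 0; exact: Mr.
Qed.

Lemma meet_card n (M : 'M[bool]_n) t u v :
  n < #|[set w | bpow M t u w]| + #|[set w | bpow M t v w]| -> meet M t u v.
Proof.
move=> lt_n; set X := [set w | _] in lt_n; set Y := [set w | _] in lt_n.
have [w] : exists w, w \in X :&: Y.
  apply/set0Pn/eqP => XY; move: lt_n; rewrite -cardsUI XY cards0 addn0.
  by rewrite ltnNge -[leqRHS]card_ord max_card.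
by rewrite !inE => /andP[]; exists w.
Qed.

(** After [n - s] steps both walkers can be on the cycle; after [n %/ 2] further laps each has at
    least [n %/ 2 + 1] possible positions, more than [n] together. *)
Lemma cycle_meet n (M : 'M[bool]_n) c s u v : primitive M -> is_cycle M c s ->
  meet M (n - s + n %/ 2 * s) u v.
Proof.
move=> primM cyc; have s0 : 0 < s by case: cyc.
have [i ui] := cycle_reach u primM cyc (leqnn _).
have [j vj] := cycle_reach v primM cyc (leqnn _).
apply: (meet_cat ui vj); apply: meet_card.
have := reach_card (n %/ 2) primM s0 (cycle_closed cyc i).
have := reach_card (n %/ 2) primM s0 (cycle_closed cyc j).
have := ltn_ord u; lia.
Qed.

Lemma meet_embed m n (M : 'M[bool]_m) (N : 'M[bool]_n) f t i j :
  (forall x y, M x y -> N (f x) (f y)) -> meet M t i j -> meet N t (f i) (f j).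
Proof.
move=> fM; have walk k x y : bpow M k x y -> bpow N k (f x) (f y).
  elim: k x => [|k IHk] x; first by rewrite !mxE => /eqP->; rewrite eqxx.
  by case/bmulP=> z /fM xz /IHk zy; apply/bmulP; exists (f z).
by case=> w /walk iw /walk jw; exists (f w).
Qed.

(** An arc that advances [e] places along [h] closes a walk of length [n - e + 1], so the girth
    forces [e <= 2]. *)
Lemma cycle_girth_arc n (N : 'M[bool]_n) h : 3 <= n -> is_cycle N h n ->
  (forall t u, 0 < t -> bpow N t u u -> n - 1 <= t) ->
  forall i x, N (h i) x -> x = h (i + 1) \/ x = h (i + 2).
Proof.
move=> n3 cyc girth i x ix.
have [j xE] := cycle_surj cyc x.
(* A loop is given [e = n] rather than 0, so that it counts as a closed walk of length 1. *)
have [e [e0 en {j}xE]] : exists e, [/\ 0 < e, e <= n & x = h (i + e)].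
  have n0 : 0 < n by lia.
  pose e := (j + (n - i %% n)) %% n.
  have ie : h (i + e) = h j.
    rewrite -(cycle_mod cyc) modnDmr -modnDml.
    have -> : i %% n + (j + (n - i %% n)) = j + 1 * n.
      by have := ltn_pmod i n0; lia.
    by rewrite (cycle_mod cyc) (cycleD cyc).
  have [e0|e0] := posnP e; last first.
    by exists e; rewrite xE ie; split=> //; apply: ltnW; rewrite ltn_mod.
  exists n; split=> //; rewrite xE -ie e0 addn0.
  by have := cycleD cyc i 1; rewrite mul1n.
have : n - 1 <= 1 + (n - e).
  apply: (girth _ (h i)) => //; apply: (@bpow_cat _ _ _ _ _ x); first by rewrite bpow1.
  have := cycle_walk cyc (i + e) (n - e); rewrite xE.
  have -> : i + e + (n - e) = i + 1 * n by lia.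
  by rewrite (cycleD cyc).
move=> e2; have [eE|eE] : e = 1 \/ e = 2 by lia.
  by left; rewrite xE eE.
by right; rewrite xE eE.
Qed.

(** * Girth b - 1 *)

(** Without a chord every arc follows [h], so [c] would run along [h] and could not close after
    [n - 1] steps. *)
Lemma hamiltonian_chord n (N : 'M[bool]_n) h c : 3 <= n -> is_cycle N h n ->
  is_cycle N c (n - 1) ->
  (forall t u, 0 < t -> bpow N t u u -> n - 1 <= t) ->
  exists a, N (h a) (h (a + 2)).
Proof.
move=> n3 hcyc ccyc girth; have n0 : 0 < n by lia.
have [/existsP[a ha]|/existsPn noch] :=
  boolP [exists a : 'I_n, N (h a) (h (a + 2))]; first by exists a.
have arc a x : N (h a) x -> x = h (a + 1).
  move=> ax; have [//|xE] := cycle_girth_arc n3 hcyc girth ax.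
  have := noch (Ordinal (ltn_pmod a n0)); rewrite /= -[h (_ + 2)](cycle_mod hcyc).
  by rewrite modnDml !(cycle_mod hcyc) -xE ax.
have [a c0E] := cycle_surj hcyc (c 0).
have cE k : c k = h (a + k).
  elim: k => [|k IHk]; first by rewrite addn0.
  rewrite -addn1 addnA; apply: arc; rewrite -IHk addn1.
  by case: ccyc.
have : h a = h (a + (n - 1)).
  by rewrite -cE -c0E; have := cycleD ccyc 0 1; rewrite add0n mul1n.
by move/(cycle_inj_near hcyc); lia.
Qed.

(** Vertex 0 of [W n] is placed at the head of the chord, so that the vertices [n - 2] and [n - 1]
    fall on [h a] and [h (a + 1)], both of which have an arc to it. *)
Lemma chord_embed n (N : 'M[bool]_n) h a : 3 <= n -> is_cycle N h n ->
  N (h a) (h (a + 2)) ->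
  forall x y : 'I_n, W n x y -> N (h (a + 2 + x)) (h (a + 2 + y)).
Proof.
move=> n3 cyc ha x y; have hM : forall i, N (h i) (h i.+1) by case: cyc.
rewrite WE => /orP[/eqP->|/andP[/eqP-> xn]].
  by have -> : a + 2 + x.+1 = (a + 2 + x).+1 by lia.
rewrite addn0; have := ltn_ord x => xlt.
have [xE|xE] := eqVneq (x : nat) (n - 2).
  have -> : a + 2 + x = a + 1 * n by lia.
  by rewrite (cycleD cyc).
have -> : a + 2 + x = a + 1 + 1 * n by lia.
by rewrite (cycleD cyc) addn1 addn2; apply: hM.
Qed.

Lemma rotation_inj n (N : 'M[bool]_n) h a : is_cycle N h n ->
  injective (fun x : 'I_n => h (a + x)).
Proof.
move=> cyc x y /(cycle_inj_near cyc) xy; apply/val_inj => /=.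
by have := ltn_ord x; have := ltn_ord y; lia.
Qed.

Lemma rotation_meet n (N : 'M[bool]_n) h a (x y : 'I_n) : 3 <= n ->
  is_cycle N h n -> N (h a) (h (a + 2)) ->
  ~~ critical_pair x y -> ~~ critical_pair y x ->
  meet N (crit n) (h (a + 2 + x)) (h (a + 2 + y)).
Proof.
move=> n3 cyc ha nxy nyx.
apply: (@meet_embed _ _ (W n) _ (fun x : 'I_n => h (a + 2 + x))).
  exact: chord_embed.
exact: W_meet_crit.
Qed.

(* A Hamiltonian cycle with one chord [h a -> h (a + 2)] is a copy of [W_n]; a
   second chord gives another copy with a different critical pair, unless the
   two chords together close a cycle of length [n - 2]. *)
Lemma hamiltonian_scrambled_or_W n (N : 'M[bool]_n) h c : 3 <= n ->
  is_cycle N h n -> is_cycle N c (n - 1) ->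
  (forall t u, 0 < t -> bpow N t u u -> n - 1 <= t) ->
  (forall u v, meet N (crit n) u v) \/
  exists2 f : 'I_n -> 'I_n, injective f & forall i j, N (f i) (f j) = W n i j.
Proof.
move=> n3 cyc ccyc girth.
have [a ha] := hamiltonian_chord n3 cyc ccyc girth.
pose f (x : 'I_n) := h (a + 2 + x).
have finj : injective f by apply: rotation_inj cyc.
have [/forallP noextra|] := boolP [forall i, forall j, N (f i) (f j) ==> W n i j].
  right; exists f => // i j; apply/idP/idP; last exact: chord_embed.
  by have /forallP/(_ j)/implyP := noextra i.
case/forallPn=> i /forallPn[j]; rewrite negb_imply => /andP[ij nW]; left.
have ilt := ltn_ord i; have jlt := ltn_ord j.
(* An arc outside the copy of [W n] must advance two places, and [i = n - 2] would give the first
   chord again. *)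
have [i2 ch] : i != n - 2 :> nat /\ N (h (a + 2 + i)) (h (a + 2 + i + 2)).
  move: nW; rewrite WE.
  case: (cycle_girth_arc n3 cyc girth ij) => /(cycle_inj_near cyc) fj.
    by lia.
  move=> nW; have i2 : i != n - 2 :> nat by lia.
  split=> //; move: ij; rewrite /f.
  suff -> : h (a + 2 + j) = h (a + 2 + i + 2) by [].
  have [->//|<-] : a + 2 + j = a + 2 + i + 2 \/ a + 2 + j + 1 * n = a + 2 + i + 2.
    by lia.
  by rewrite (cycleD cyc).
pose f' (x : 'I_n) := h (a + 2 + i + 2 + x).
have f'inj : injective f' by apply: rotation_inj cyc.
have crit_f (x y : 'I_n) : critical_pair x y -> meet N (crit n) (f x) (f y).
  case/andP=> /eqP xE /eqP yE.
  have [g _ gK] := injF_bij f'inj.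
  rewrite -(gK (f x)) -(gK (f y)).
  (* If the critical pairs agreed in this order, the last vertices of the two copies would coincide,
     forcing [i = n - 2]. *)
  have [/andP[_ /eqP gy]|n1] := boolP (critical_pair (g (f x)) (g (f y))).
    have := gK (f y); rewrite /f /f' gy yE => /(cycle_inj_near cyc).
    lia.
  have [/andP[/eqP gy /eqP gx]|n2] := boolP (critical_pair (g (f y)) (g (f x))).
    have := gK (f y); rewrite /f /f' gy yE => /(cycle_inj_near cyc) Ey.
    have := gK (f x); rewrite /f /f' gx xE => /(cycle_inj_near cyc) Ex.
    have {Ex Ey}[iE nE] : i.+1 = (n %/ 2).-1 /\ n = 2 * (n %/ 2) by lia.
    (* From [h (a + 2)] along [h] to the second chord, across it, on to [h a] and across the first
       chord: a closed walk of length [n - 2]. *)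
    suff : n - 1 <= i + (1 + ((n - 4 - i) + 1)) by lia.
    apply: (girth _ (h (a + 2))); first by lia.
    apply: bpow_cat (cycle_walk cyc _ i) _.
    apply: (@bpow_cat _ _ _ _ _ (h (a + 2 + i + 2))); first by rewrite bpow1.
    apply: bpow_cat (cycle_walk cyc _ (n - 4 - i)) _; rewrite bpow1.
    have -> : a + 2 + i + 2 + (n - 4 - i) = a + 1 * n by lia.
    by rewrite (cycleD cyc).
  exact: rotation_meet.
move=> u v; have [g _ gK] := injF_bij finj; rewrite -(gK u) -(gK v).
have [/crit_f//|n1] := boolP (critical_pair (g u) (g v)).
have [/crit_f/meetC//|n2] := boolP (critical_pair (g v) (g u)).
exact: rotation_meet.
Qed.

(** * Even order b and girth b - 2 *)

(** In [s + 1] steps the walker on the cycle gains one place on a walker that returns to its own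
    starting point. *)
Lemma cycle_catch_up n (N : 'M[bool]_n) c s i d : is_cycle N c s ->
  bpow N s.+1 (c (i + d)) (c (i + d)) -> meet N (d * s.+1) (c i) (c (i + d)).
Proof.
move=> cyc lap; exists (c (i + d)); last exact: bpow_laps.
have := cycle_walk cyc i (d * s.+1).
have -> : i + d * s.+1 = i + d + d * s by lia.
by rewrite (cycleD cyc).
Qed.

(** If the target has no closed walk of length [s + 1], its successor on the cycle has one, and
    [2 * d < s] leaves time to advance both walkers by one step first. If [2 * d = s], the two
    vertices are opposite and either can be the target. *)
Lemma cycle_catch_up_leq n (N : 'M[bool]_n) c s i d : is_cycle N c s ->
  serial N -> 2 <= s -> 2 %| s -> 2 * d <= s ->
  (forall x y, x != y -> bpow N s.+1 x x \/ bpow N s.+1 y y) ->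
  meet N (s %/ 2 * s.+1) (c i) (c (i + d)).
Proof.
move=> cyc serN s2 evs ds lap; have [d0|d0] := posnP d.
  apply: (@meet_leq _ _ 0) => //; exists (c i); rewrite ?mxE ?d0 ?addn0 ?eqxx //.
have neq j k : k = j + d -> c j != c k.
  move=> ->; apply/eqP => /(cycle_inj_near cyc); lia.
have [dE|dE] := eqVneq (2 * d) s.
  have -> : s %/ 2 = d by lia.
  have [lapi|lapd] := lap _ _ (neq i (i + d) erefl); last exact: cycle_catch_up.
  have cE : c (i + d + d) = c i.
    have -> : i + d + d = i + 1 * s by lia.
    by rewrite (cycleD cyc).
  apply: meetC; have := @cycle_catch_up _ _ _ _ (i + d) d cyc; rewrite cE.
  exact.
have neq1 : c (i + d) != c (i.+1 + d).
  by apply/eqP => /(cycle_inj_near cyc); lia.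
have dle : d.+1 * s.+1 <= s %/ 2 * s.+1 by rewrite leq_mul2r; lia.
have [lapd|lapd] := lap _ _ neq1.
  by apply: meet_leq (cycle_catch_up cyc lapd) => //; lia.
apply: (@meet_leq _ _ (1 + d * s.+1)) => //; first by lia.
apply: (@meet_cat _ _ _ _ _ _ (c i.+1) (c (i.+1 + d))); rewrite ?bpow1.
- by case: cyc.
- by rewrite addSn; case: cyc.
exact: cycle_catch_up.
Qed.

Lemma cycle_pair_meet n (N : 'M[bool]_n) c s i j : is_cycle N c s ->
  serial N -> 2 <= s -> 2 %| s ->
  (forall x y, x != y -> bpow N s.+1 x x \/ bpow N s.+1 y y) ->
  meet N (s %/ 2 * s.+1) (c i) (c j).
Proof.
move=> cyc serN s2 evs lap; have s0 : 0 < s by lia.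
rewrite -(cycle_mod cyc i) -(cycle_mod cyc j).
have := ltn_pmod i s0; have := ltn_pmod j s0.
move: (i %% s) (j %% s) => {}i {}j; wlog ij : i j / i <= j => [hwlog|] js is_.
  have [le_ij|/ltnW le_ji] := leqP i j; first exact: hwlog.
  by apply: meetC; apply: hwlog.
have [ds|ds] := leqP (2 * (j - i)) s.
  by rewrite -(subnKC ij); apply: cycle_catch_up_leq.
apply: meetC; have -> : c i = c (j + (s - (j - i))).
  have -> : j + (s - (j - i)) = i + 1 * s by lia.
  by rewrite (cycleD cyc).
by apply: cycle_catch_up_leq => //; lia.
Qed.

(** The cycle [c'] misses only one vertex, so of any two vertices one has a closed walk of length
    [s + 1]. If [u] and [v] both have arcs into [c], one step reduces to [cycle_pair_meet]. *)
Lemma girth_meet_outside n (N : 'M[bool]_n) c c' s u v :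
  n = s + 2 -> 2 <= s -> 2 %| s -> primitive N -> is_cycle N c s ->
  is_cycle N c' s.+1 ->
  (forall x, ~~ N x x) -> u \notin cycle_set c s -> v \notin cycle_set c s ->
  u != v -> meet N (s %/ 2 * s.+1 + 1) u v.
Proof.
move=> nE s2 evs primN cyc cyc' noloop; have serN := primitive_serial primN.
have uvE x y z : x \notin cycle_set c s -> y \notin cycle_set c s -> x != y ->
    z \notin cycle_set c s -> z = x \/ z = y.
  move=> xC yC xy zC; have [->|zx] := eqVneq z x; first by left.
  have [->|zy] := eqVneq z y; first by right.
  have : #|~: cycle_set c s| = 2.
    by rewrite cardsCs setCK (card_cycle_set cyc) card_ord; lia.
  have /subset_leq_card : [set x; y; z] \subset ~: cycle_set c s.
    by apply/subsetP => w; rewrite !inE => /orP[/orP[]|] /eqP->.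
  rewrite -setUA cardsU1 cards2 !inE negb_or xy [x == z]eq_sym zx [y == z]eq_sym zy; lia.
have lapE x : x \in cycle_set c' s.+1 -> bpow N s.+1 x x.
  by case/(cycle_setP _ cyc') => i ->; apply: cycle_closed.
have out x y : x \notin cycle_set c' s.+1 -> y \notin cycle_set c' s.+1 -> x = y.
  move=> xC yC; apply/eqP; apply: contraT => xy.
  have : #|~: cycle_set c' s.+1| = 1.
    by rewrite cardsCs setCK (card_cycle_set cyc') card_ord; lia.
  have /subset_leq_card : [set x; y] \subset ~: cycle_set c' s.+1.
    by apply/subsetP => w; rewrite !inE => /orP[] /eqP->.
  rewrite cards2 xy; lia.
have lap x y : x != y -> bpow N s.+1 x x \/ bpow N s.+1 y y.
  have [/lapE|xC] := boolP (x \in cycle_set c' s.+1); first by left.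
  have [/lapE|yC] := boolP (y \in cycle_set c' s.+1); first by right.
  by rewrite (out _ _ xC yC) eqxx.
(* If [x] has no arc into the cycle, it follows [y] with a delay of one step. *)
have delayed x y : x \notin cycle_set c s -> y \notin cycle_set c s -> x != y ->
    (forall i, ~~ N x (c i)) -> meet N (s %/ 2 * s.+1 + 1) x y.
  move=> xC yC xy xc.
  have xout z : N x z -> z = y.
    move=> xz; have [/(cycle_setP _ cyc)[i zE]|zC] := boolP (z \in cycle_set c s).
      by have := xc i; rewrite -zE xz.
    have [zE|//] := uvE _ _ _ xC yC xy zC.
    by have := noloop x; rewrite -{2}zE xz.
  have xNy : N x y by have [z xz] := serN x; rewrite -(xout z xz).
  have [i yi] : exists i, N y (c i).
    have n2 : n - s <= 2 by lia.
    have [i] := cycle_reach x primN cyc n2.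
    by rewrite (bpowD _ 1 1) bpow1 => /bmulP[z /xout->]; exists i.
  (* If [c i] is the vertex missed by [c'], then [c'] runs through [x] and [y], and the vertex after
     [y] lies on both cycles. *)
  have [j yj lapj] : exists2 j, N y (c j) & bpow N s.+1 (c j) (c j).
    have [/lapE|iC] := boolP (c i \in cycle_set c' s.+1); first by exists i.
    have inC' z : z != c i -> z \in cycle_set c' s.+1.
      by move=> zi; apply: contraT => /out/(_ iC) zE; rewrite zE eqxx in zi.
    have inC z : z \notin cycle_set c s -> z != c i.
      by apply: contraNneq => ->; apply/(cycle_setP _ cyc); exists i.
    have /(cycle_setP _ cyc')[k xk] := inC' _ (inC _ xC).
    have c'N : forall m, N (c' m) (c' m.+1) by case: cyc'.
    have yk : c' k.+1 = y by apply: xout; rewrite xk.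
    have [/(cycle_setP _ cyc)[j jE]|kC] := boolP (c' k.+2 \in cycle_set c s).
      exists j; rewrite -jE; first by rewrite -yk.
      exact: cycle_closed.
    have [E|E] := uvE _ _ _ xC yC xy kC.
      by move: E; rewrite xk => /(cycle_inj_near cyc'); lia.
    by have := noloop y; rewrite -{2}E -yk c'N.
  (* From [x], two steps through [y] and a lap of length [s]; from [y], one step and a lap of length
     [s + 1]. *)
  apply: (@meet_leq _ _ (2 + s)) => //; first by nia.
  exists (c j).
    apply: (@bpow_cat _ _ 2 s _ (c j)); last exact: cycle_closed.
    by rewrite (bpowD _ 1 1) bpow1; apply/bmulP; exists y.
  by apply/bmulP; exists (c j).
move=> uC vC uv.
have hasC x : (exists i, N x (c i)) \/ forall i, ~~ N x (c i).
  have [/existsP[i xi]|/existsPn xi] := boolP [exists i : 'I_s, N x (c i)].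
    by left; exists i.
  right=> i; have s0 : 0 < s by lia.
  by have := xi (Ordinal (ltn_pmod i s0)); rewrite /= (cycle_mod cyc).
have [[i ui]|uc] := hasC u; last exact: delayed.
have [[j vj]|vc] := hasC v; last by apply/meetC/delayed; rewrite 1?eq_sym.
rewrite addnC; apply: (@meet_cat _ _ _ _ _ _ (c i) (c j)); rewrite ?bpow1 //.
exact: cycle_pair_meet.
Qed.

(** If one walker starts on [c], it has [n %/ 2 + 1] possible positions; the other spends one lap's
    time to reach [c] and still has [n %/ 2], which makes more than [n] in all. *)
Lemma girth_meet_even n (N : 'M[bool]_n) c c' s u v :
  n = s + 2 -> 2 <= s -> 2 %| s -> primitive N -> is_cycle N c s ->
  is_cycle N c' s.+1 -> (forall x, ~~ N x x) -> meet N (n %/ 2 * s) u v.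
Proof.
move=> nE s2 evs primN cyc cyc' noloop; have serN := primitive_serial primN.
have s0 : 0 < s by lia.
have inC x y : x \in cycle_set c s -> meet N (n %/ 2 * s) x y.
  case/(cycle_setP _ cyc) => i ->; apply: meet_card.
  have ns : n - s <= s by lia.
  have [j yj] := cycle_reach y primN cyc ns.
  have := reach_card (n %/ 2) primN s0 (cycle_closed cyc i).
  have := reach_card (s %/ 2) primN s0 (cycle_closed cyc j).
  have /subset_leq_card : [set w | bpow N (s %/ 2 * s) (c j) w]
      \subset [set w | bpow N (n %/ 2 * s) y w].
    apply/subsetP => w; rewrite !inE => jw.
    have -> : n %/ 2 * s = s + s %/ 2 * s by rewrite -mulSn; congr (_ * _); lia.
    exact: bpow_cat jw.
  by have := ltn_ord y; lia.
have [/inC//|uC] := boolP (u \in cycle_set c s).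
have [/inC/meetC//|vC] := boolP (v \in cycle_set c s).
have [->|uv] := eqVneq u v.
  by apply: (@meet_leq _ _ 0) => //; exists v; rewrite mxE eqxx.
apply: meet_leq (girth_meet_outside nE s2 evs primN cyc cyc' noloop uC vC uv) => //.
nia.
Qed.

(** * Primitive matrices that scramble late *)

(** The left side does not decrease with [s], so only the largest admissible [s] matters: [b - 2]
    for odd [b], [b - 3] for even [b]. *)
Lemma crit_cycle b s : 3 <= b -> 2 <= s -> s <= b - 2 ->
  (odd b || (s <= b - 3)) -> b - s + b %/ 2 * s <= crit b.
Proof.
move=> b3 s2 sb obs; have [h [h0 [[bE ->]|[bE h2 ->]]]] := crit_cases b3.
  have -> : b %/ 2 = h by lia.
  have sb' : s <= 2 * h - 1 by lia.
  by have := leq_mul (leqnn (h - 1)) sb'; nia.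
have -> : b %/ 2 = h by lia.
have sb' : s <= 2 * h - 3 by move: obs; rewrite bE; lia.
have := leq_mul (leqnn (h - 1)) sb'; rewrite bE; nia.
Qed.

Lemma scrambled_or_W b (N : 'M[bool]_b) : 3 <= b -> primitive N ->
  (forall u v, meet N (crit b) u v) \/
  exists2 f : 'I_b -> 'I_b, injective f & forall i j, N (f i) (f j) = W b i j.
Proof.
move=> b3 primN; have serN := primitive_serial primN; have b0 : 0 < b by lia.
(* Modulus 0 excludes only the empty walk, so [s] is the girth. *)
have [s [c [cyc s0 smin]]] := @minimal_cycle _ N 0 b0 primN isT.
rewrite dvd0n -lt0n in s0.
have girth t u : 0 < t -> bpow N t u u -> s <= t.
  by move=> t0 /smin; rewrite dvd0n -lt0n; apply.
have [s1|s1] := eqVneq s 1.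
  left=> u v; have [i ui] := cycle_reach u primN cyc (leqnn _).
  have [j vj] := cycle_reach v primN cyc (leqnn _).
  apply: (@meet_leq _ _ (b - s)) => //.
    have [h [h0 [[bE ->]|[bE h2 ->]]]] := crit_cases b3; nia.
  have cE k : c k = c 0 by rewrite -(cycle_mod cyc) s1 modn1.
  by exists (c 0); [rewrite -(cE i) | rewrite -(cE j)].
have s2 : 2 <= s by lia.
have noloop x : ~~ N x x.
  by apply/negP => xx; have := @girth 1 x isT; rewrite bpow1 xx; lia.
(* Modulus [s] yields a strictly longer cycle, which is Hamiltonian when [s = b - 1]. *)
have [s' [c' [cyc' ss' _]]] := minimal_cycle b0 primN s1.
have s'b := cycle_leq cyc'.
have ss'le : s < s'.
  rewrite ltn_neqAle (girth _ (c' 0)) ?cycle_closed ?andbT //; last by case: cyc'.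
  by apply: contraNneq ss' => ->.
have [sb|sb] := leqP (b - 1) s.
  have sE : s = b - 1 by lia.
  have s'E : s' = b by lia.
  rewrite sE in cyc girth; rewrite s'E in cyc'.
  exact: hamiltonian_scrambled_or_W cyc' cyc girth.
left=> u v; have [obs|] := boolP (odd b || (s <= b - 3)).
  apply: meet_leq (cycle_meet u v primN cyc) => //.
  by apply: crit_cycle => //; lia.
rewrite negb_or => /andP[evb sb'].
(* Now [b] is even and [s = b - 2]; an odd cycle length between [s] and [b] can only be [s + 1]. *)
have [s'' [c'' [cyc'' os'' _]]] := @minimal_cycle _ N 2 b0 primN isT.
have s''b := cycle_leq cyc''.
have s''0 : 0 < s'' by case: cyc''.
have ss'' := girth _ _ s''0 (cycle_closed cyc'' 0).
have bE : b = s + 2 by lia.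
have s''E : s'' = s.+1 by lia.
rewrite s''E in cyc''.
have -> : crit b = b %/ 2 * s.
  have [h [h0 [[bE' ->]|[bE' h2 ->]]]] := crit_cases b3; first lia.
  have -> : b %/ 2 = h by lia.
  have -> : s = (h - 1) * 2 by lia.
  by lia.
by apply: girth_meet_even cyc cyc'' noloop => //; lia.
Qed.

(** * Boolean rank factorizations *)

(** An index [k] that contributes nothing to the product could be deleted from both factors, against
    the minimality of the rank. *)
Lemma factor_support n b (M : 'M[bool]_n) (A : 'M[bool]_(n, b)) (B : 'M[bool]_(b, n)) :
  boolean_rank M b -> M = bmul A B ->
  forall k, (exists i, A i k) /\ (exists j, B k j).
Proof.
case: b A B => [|b] A B [_ rankM] ME k; first by case: k.
have [/existsP[i /existsP[j /andP[Aik Bkj]]]|noAB] :=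
    boolP [exists i, exists j, A i k && B k j].
  by split; [exists i | exists j].
case: (rankM b (ltnSn b)); exists (col' k A), (row' k B).
apply/matrixP => i j; rewrite ME; apply/bmulP/bmulP => [[l Ail Blj]|[l]].
  have [l' lE|lE] := unliftP k l; first by exists l'; rewrite !mxE -lE.
  case/negP: noAB; apply/existsP; exists i; apply/existsP; exists j.
  by rewrite -lE Ail.
by rewrite !mxE => Ail Blj; exists (lift k l).
Qed.

(** The power [r + 1] of [B A] is [B J A], which is full because [B] has no zero row and [A] no zero
    column. *)
Lemma primitive_swap n b (A : 'M[bool]_(n, b)) (B : 'M[bool]_(b, n)) :
  primitive (bmul A B) -> (forall k, (exists i, A i k) /\ (exists j, B k j)) ->
  primitive (bmul B A).
Proof.
case=> r [r0 /matrixP MJ] supp; exists r.+1; split=> //.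
apply/matrixP => k l; rewrite bpow_swap [RHS]mxE.
have [[i Ail] _] := supp l; have [_ [j Bkj]] := supp k.
apply/bmulP; exists j => //; apply/bmulP; exists i => //.
by rewrite MJ mxE.
Qed.

Lemma bpow_factor n b (A : 'M[bool]_(n, b)) (B : 'M[bool]_(b, n)) t i j :
  reflect (exists k l, [/\ A i k, bpow (bmul B A) t k l & B l j])
          (bpow (bmul A B) t.+1 i j).
Proof.
rewrite bpow_swap; apply: (iffP (bmulP _ _ _ _)).
  by move=> [k Aik /bmulP[l kl Blj]]; exists k, l.
by move=> [k [l [Aik kl Blj]]]; exists k => //; apply/bmulP; exists l.
Qed.

Lemma meet_factor n b (A : 'M[bool]_(n, b)) (B : 'M[bool]_(b, n)) t i j k l :
  (forall k, exists j, B k j) -> A i k -> A j l ->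
  meet (bmul B A) t k l -> meet (bmul A B) t.+1 i j.
Proof.
move=> rowB Aik Ajl [w kw lw]; have [c Bwc] := rowB w.
by exists c; apply/bpow_factor; [exists k, w | exists l, w].
Qed.

Lemma W_common_successor b (x y z : 'I_b) :
  3 <= b -> W b x z -> W b y z -> x != y -> b - 2 <= x /\ z = 0 :> nat.
Proof.
move=> b3; rewrite !WE -val_eqE /= => xz yz xy.
have := ltn_ord x; have := ltn_ord y; lia.
Qed.

Theorem theorem2p6 (n b : nat) (M : 'M[bool]_n) :
  primitive M -> boolean_rank M b -> 3 <= b -> b <= n - 1 ->
  (is_scrambling_index M (((b - 1) ^ 2 + 1 + 1) %/ 2 + 1) <->
   exists (A : 'M[bool]_(n, b)) (B : 'M[bool]_(b, n)),
     [/\ M = bmul A B,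
         bmul B A = W b,
         (exists r : 'I_n, row_is_unit A r (b %/ 2)) /\
         (exists r : 'I_n, row_is_unit A r b)
       & ~ (exists c : 'I_n, forall j : 'I_b,
              B j c = (nat_of_ord j == b - 2) || (nat_of_ord j == b - 1))]).
Proof.
move=> primM rankM b3 _; have serM := primitive_serial primM.
have -> : ((b - 1) ^ 2 + 1 + 1) %/ 2 + 1 = (crit b).+2 by rewrite /crit; lia.
have lp : (b %/ 2).-1 < b by lia.
have lb : b.-1 < b by lia.
pose p := Ordinal lp; pose l := Ordinal lb.
have cpl : critical_pair p l by rewrite /critical_pair !eqxx.
have rowA (A : 'M[bool]_(n, b)) B : M = bmul A B -> forall i, exists k, A i k.
  by move=> ME i; have [j] := serM i; rewrite ME => /bmulP[k]; exists k.
split=> [[_ [scr nscr]]|[A [B [ME BA [[r1 Ar1] [r2 Ar2]] colB]]]]; last first.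
  have suppAB := factor_support rankM ME.
  have rowB k : exists j, B k j by have [] := suppAB k.
  split=> //; split.
    apply/scramblesP => i j; have [k Aik] := rowA _ _ ME i.
    have [m Ajm] := rowA _ _ ME j; rewrite ME; apply: (meet_factor rowB Aik Ajm).
    by rewrite BA; apply: W_scrambles.
  (* By monotonicity it suffices that the rows [r1] and [r2] do not meet after [crit b + 1]
     steps. *)
  move=> k' _ k'lt /scramblesP/(_ r1 r2) /(@meet_leq _ _ _ (crit b).+1).
  case=> // c; rewrite ME => /bpow_factor[x0 [x [Ax0 x0x Bxc]]].
  case/bpow_factor=> y0 [y [Ay0 y0y Byc]].
  have x0E : x0 = p by apply/val_inj/eqP; rewrite -Ar1.
  have y0E : y0 = l by apply/val_inj/eqP; rewrite -Ar2.
  rewrite BA x0E y0E in x0x y0y.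
  have xy : x != y.
    apply/eqP => xy; apply: (W_not_meet_crit b3 cpl); exists x => //.
    by rewrite xy.
  (* All rows of [B] with a 1 in column [c] are predecessors of [z] in [W b]. Two of them are
     distinct, so they are the last two vertices and column [c] is the excluded one. *)
  have [z Acz] := rowA _ _ ME c.
  have WB j : B j c -> W b j z by move=> Bjc; rewrite -BA; apply/bmulP; exists c.
  have [x2 z0] := W_common_successor b3 (WB _ Bxc) (WB _ Byc) xy.
  rewrite eq_sym in xy.
  have [y2 _] := W_common_successor b3 (WB _ Byc) (WB _ Bxc) xy.
  case: colB; exists c => j; apply/idP/idP => [/WB|jE].
    by rewrite WE z0; have := ltn_ord j; lia.
  have [->|->] // : j = x \/ j = y.
  move: xy; rewrite -val_eqE /= => xy; have := ltn_ord x; have := ltn_ord y.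
  by have [jx|jx] := eqVneq (j : nat) x => ? ?; [left|right]; apply/val_inj => /=; lia.
case: (rankM) => -[A0 [B0 ME0]] _; have suppAB := factor_support rankM ME0.
have rowB0 k : exists j, B0 k j by have [] := suppAB k.
have primN : primitive (bmul B0 A0).
  by apply: primitive_swap suppAB; rewrite -ME0.
have [scrN|[f finj fW]] := scrambled_or_W b3 primN.
  case: (nscr (crit b).+1 isT (ltnSn _)); apply/scramblesP => i j.
  have [k Aik] := rowA _ _ ME0 i; have [m Ajm] := rowA _ _ ME0 j.
  by rewrite ME0; apply: (meet_factor rowB0 Aik Ajm).
have [g gK fK] := injF_bij finj.
pose A : 'M[bool]_(n, b) := (\matrix_(i, k) A0 i (f k))%R.
pose B : 'M[bool]_(b, n) := (\matrix_(k, j) B0 (f k) j)%R.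
have ME : M = bmul A B.
  rewrite ME0; apply/matrixP => i j; apply/bmulP/bmulP => -[k].
    by move=> Aik Bkj; exists (g k); rewrite mxE fK.
  by rewrite !mxE; exists (f k).
have BA : bmul B A = W b.
  apply/matrixP => k m; rewrite -fW; apply/bmulP/bmulP => -[i].
    by rewrite !mxE; exists i.
  by move=> Bki Aim; exists i; rewrite mxE.
exists A, B; have rowB k : exists j, B k j by have [] := factor_support rankM ME k.
have [i [j nij]] : exists i j,
    ~~ [exists w, bpow M (crit b).+1 i w && bpow M (crit b).+1 j w].
  have [/forallP allm|/forallPn[i /forallPn[j nij]]] := boolP
      [forall i, forall j, exists w, bpow M (crit b).+1 i w && bpow M (crit b).+1 j w].
    case: (nscr (crit b).+1 isT (ltnSn _)); apply/scramblesP => i j.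
    by have /forallP/(_ j)/exists_inP := allm i.
  by exists i, j.
have {}nij : ~ meet M (crit b).+1 i j by move/exists_inP; apply/negP.
(* Any other pair of vertices meets in [W b] after [crit b] steps, and the rows [i] and [j] would
   then meet in [M]. *)
have ncrit k m : A i k -> A j m -> critical_pair k m || critical_pair m k.
  move=> Aik Ajm; apply: contraT; rewrite negb_or => /andP[n1 n2].
  case: nij; rewrite ME; apply: (meet_factor rowB Aik Ajm).
  by rewrite BA; apply: W_meet_crit.
have pl : (b %/ 2).-1 < b.-1 by lia.
wlog [Aip Ajl] : i j nij ncrit / A i p /\ A j l.
  move=> hwlog; have [k Aik] := rowA _ _ ME i; have [m Ajm] := rowA _ _ ME j.
  have critE x y : critical_pair x y -> x = p /\ y = l.
    by case/andP=> /eqP xE /eqP yE; split; apply/val_inj.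
  have [] := orP (ncrit k m Aik Ajm) => /critE[kE mE].
    by apply: (hwlog i j) => //; rewrite -kE -mE.
  apply: (hwlog j i); rewrite -?kE -?mE //; first by move/meetC.
  by move=> x y Ajx Aiy; rewrite orbC; apply: ncrit.
(* Each entry of row [i] must be critical with [l], and [l] cannot be the first member of a critical
   pair, by [pl]. *)
have Ai k : A i k = (k == p :> nat).
  apply/idP/eqP => [Aik|/val_inj->//].
  by move: (ncrit _ _ Aik Ajl); rewrite /critical_pair /=; lia.
have Aj k : A j k = (k == l :> nat).
  apply/idP/eqP => [Ajk|/val_inj->//].
  by move: (ncrit _ _ Aip Ajk); rewrite /critical_pair /=; lia.
split=> //; first by split; [exists i | exists j].
case=> c Bc; case: nij.
(* One step before they meet, the walkers from [p] and [l] stand on the last two vertices; an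
   excluded column [c] would let both move to [c], so [i] and [j] would meet. *)
have [z pz lz] := W_scrambles p l b3; rewrite -addn1 bpowD bpow1 in pz lz.
have [x px xz] := bmulP _ _ _ _ pz; have [y ly yz] := bmulP _ _ _ _ lz.
have xy : x != y.
  by apply/eqP => xy; apply: (W_not_meet_crit b3 cpl); exists x; rewrite // xy.
have [x2 _] := W_common_successor b3 xz yz xy; rewrite eq_sym in xy.
have [y2 _] := W_common_successor b3 yz xz xy.
exists c; rewrite ME; apply/bpow_factor.
  by exists p, x; rewrite BA Bc; split=> //; have := ltn_ord x; lia.
by exists l, y; rewrite BA Bc; split=> //; have := ltn_ord y; lia.
Qed.
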